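(* Let $G$ be a connected graph and $x\in V(G)$ a vertex such that $G-x$ is connected. Then $\mu(G-x)\le 2\,\mu(G)$.
   Context: All graphs are finite, simple and connected; $G-x$ is the graph obtained by deleting $x$ and its incident edges. For a connected graph $G$ and $X\subseteq V(G)$, two vertices $u,v$ are $X$-visible if there is a shortest $u,v$-path $P$ in $G$ with $V(P)\cap X\subseteq\{u,v\}$. $X$ is a mutual-visibility set if every two $u,v\in X$ are $X$-visible; $\mu(G)$ is the maximum cardinality of a mutual-visibility set in $G$. *)

(* Defs.v *)
From HB Require Import structures.
From mathcomp Require Import all_boot.
From mathcomp Require Import boolp.

Set Implicit Arguments.
Unset Strict Implicit.
Unset Printing Implicit Defensive.

Record sgraph := SGraph {
  vertex :> finType;
  adj : rel vertex;
  adj_sym : symmetric adj;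
  adj_irrefl : irreflexive adj }.

Definition connected (G : sgraph) : Prop := forall u v : G, connect (@adj G) u v.

Section DeleteVertex.
Variables (G : sgraph) (x : G).

Definition del_vertex_adj : rel {y : G | y != x} :=
  fun u v => adj (val u) (val v).

Lemma del_vertex_sym : symmetric del_vertex_adj.
Proof. by move=> u v; apply: adj_sym. Qed.

Lemma del_vertex_irrefl : irreflexive del_vertex_adj.
Proof. by move=> u; apply: adj_irrefl. Qed.

Definition del_vertex : sgraph := SGraph del_vertex_sym del_vertex_irrefl.

End DeleteVertex.

(* The vertex sequence of the path is [u :: p], so [size p] is its length. *)
Definition is_path (G : sgraph) (u v : G) (p : seq G) : Prop :=
  [/\ path (@adj G) u p, last u p = v & uniq (u :: p)].

Definition shortest_path (G : sgraph) (u v : G) (p : seq G) : Prop :=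
  is_path u v p /\ forall q : seq G, is_path u v q -> size p <= size q.

Definition visible (G : sgraph) (X : {set G}) (u v : G) : Prop :=
  exists2 p : seq G, shortest_path u v p &
    forall w : G, w \in u :: p -> w \in X -> w = u \/ w = v.

Definition mutual_visibility_set (G : sgraph) (X : {set G}) : Prop :=
  forall u v : G, u \in X -> v \in X -> visible X u v.

Definition mu (G : sgraph) : nat :=
  \max_(X : {set G} | `[< mutual_visibility_set X >]) #|X|.

(* Main.v *)
Require Import Defs.
From mathcomp Require Import all_boot.
From mathcomp Require Import boolp.

(** Let [X] be a mutual-visibility set of [G - x], let [A] be the set of those
    vertices of [X] that see [x] in [G] without meeting [X] in between, and let
    [B = X \ A].  It suffices that [A] and [B] are both mutual-visibility sets
    of [G].

    A subset [Y] of [X] all of whose vertices [Y]-see [x] is a mutual-visibility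
    set of [G]: if the distance of [u] and [v] is the same in [G] and [G - x],
    the [X]-free geodesic of [G - x] does the job, and otherwise every geodesic
    runs through [x], so that the two geodesics towards [x] can be glued.
    This applies to [A] directly.  For [b] in [B], let [w] be the last vertex of
    [X] on a geodesic from [b] to [x]; then [w] is in [A], and the part from [b]
    to [w] can be replaced by an [X]-free geodesic of [G - x], whence [b]
    [B]-sees [x]. *)

Set Implicit Arguments.
Unset Strict Implicit.
Unset Printing Implicit Defensive.

Section Walks.
Variable G : sgraph.
Implicit Types (u v w : G) (p q : seq G) (X Y : {set G}).

(** Repeated vertices are allowed, so walks can be concatenated and reversed freely;
    [shortest_walk_path] turns a shortest one back into a path. *)
Definition is_walk u v p : Prop := path (@adj G) u p /\ last u p = v.

Lemma is_path_walk u v p : is_path u v p -> is_walk u v p.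
Proof. by case. Qed.

Lemma is_walk_cat u w v p q :
  is_walk u w p -> is_walk w v q -> is_walk u v (p ++ q).
Proof.
move=> [pp lp] [pq lq]; split; last by rewrite last_cat lp.
by rewrite cat_path pp lp.
Qed.

Lemma is_walk_rev u v p : is_walk u v p -> is_walk v u (rev (belast u p)).
Proof.
move=> [pp <-]; split.
  by rewrite rev_path (eq_path (e' := @adj G)) // => a b; rewrite /= adj_sym.
by case: p {pp} => //= y s; rewrite rev_cons last_rcons.
Qed.

Lemma is_walk_split u v w p :
  is_walk u v p -> w \in u :: p ->
  exists p1 p2, [/\ p = p1 ++ p2, is_walk u w p1 & is_walk w v p2].
Proof.
move=> [pp lp] wp; case/splitPl: wp pp lp => p1 p2 lp1.
by rewrite cat_path last_cat lp1 => /andP[pp1 pp2] lp2; exists p1, p2.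
Qed.

Lemma walk_path u v p :
  is_walk u v p ->
  exists q, [/\ is_path u v q, size q <= size p & {subset u :: q <= u :: p}].
Proof.
move=> [pp <-]; case/shortenP: pp => q pq uq sq; exists q; split=> //.
  by apply: uniq_leq_size => //; case/andP: uq.
by move=> y; rewrite !inE => /orP[-> //|/sq ->]; rewrite orbT.
Qed.

Lemma shortest_path_min u v p q :
  shortest_path u v p -> is_walk u v q -> size p <= size q.
Proof. by move=> [_ min_p] /walk_path[r [/min_p pr rq _]]; apply: leq_trans rq. Qed.

Lemma shortest_walk_path u v p :
  is_walk u v p -> (forall q, is_walk u v q -> size p <= size q) ->
  shortest_path u v p.
Proof.
move=> wp min_p; split; last by move=> q /is_path_walk; apply: min_p.
have [q [[pq lq uq] _ sqp]] := walk_path wp; have [pp lp] := wp.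
(* The duplicate-free [u :: q] lies inside [u :: p] and, by minimality of [p], is at least as long,
   which leaves no room for a repetition in [u :: p]. *)
split=> //; apply: leq_size_uniq uq sqp _.
by rewrite /= ltnS; apply: min_p.
Qed.

Lemma shortest_path_exists u v :
  connected G -> exists p, shortest_path u v p.
Proof.
move=> /(_ u v) /connectP[p0 pp0 lp0].
have exn : exists n, `[< exists2 p, is_walk u v p & size p = n >].
  by exists (size p0); apply/asboolP; exists p0.
case: (ex_minnP exn) => n /asboolP[p wp <-] min_n; exists p.
by apply: shortest_walk_path => // q wq; apply: min_n; apply/asboolP; exists q.
Qed.

(** A shorter walk from [w] to [v], preceded by [p], would beat [p ++ q]. *)
Lemma shortest_path_suffix u w v p q :
  shortest_path u v (p ++ q) -> is_walk u w p -> is_walk w v q ->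
  shortest_path w v q.
Proof.
move=> sp wp wq; apply: shortest_walk_path => // r wr.
have := shortest_path_min sp (is_walk_cat wp wr).
by rewrite !size_cat leq_add2l.
Qed.

Lemma visible_sub X Y u v : Y \subset X -> visible X u v -> visible Y u v.
Proof.
by move=> /subsetP sYX [p sp Hp]; exists p => // w wp /sYX; apply: Hp.
Qed.

Lemma split_last_in X u p : u \in X ->
  exists p1 p2, [/\ p = p1 ++ p2, last u p1 \in X
    & forall w, w \in p2 -> w \notin X].
Proof.
move=> uX; elim/last_ind: p => [|p y [p1 [p2 [-> lX nX]]]].
  by exists [::], [::].
have [yX|yX] := boolP (y \in X).
  by exists (rcons (p1 ++ p2) y), [::]; rewrite cats0 last_rcons.
exists p1, (rcons p2 y); rewrite rcons_cat; split=> // w.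
by rewrite mem_rcons inE => /orP[/eqP ->|/nX].
Qed.

End Walks.

Section DeletedVertex.
Variables (G : sgraph) (x : G).
Local Notation H := (del_vertex x).

Definition del_val (u : H) : G := val u.

Lemma del_val_inj : injective del_val. Proof. exact: val_inj. Qed.

Lemma del_val_neq (u : H) : del_val u != x. Proof. exact: valP u. Qed.

Lemma is_walk_del_val (u v : H) (p : seq H) :
  is_walk (del_val u) (del_val v) (map del_val p) <-> is_walk u v p.
Proof.
rewrite /is_walk last_map path_map; split=> -[pp lp]; split=> //.
- exact: del_val_inj.
- by rewrite lp.
Qed.

(** With [is_walk_del_val], this turns a walk of [G] between vertices of [H] that avoids [x] into a
    walk of [H]. *)
Lemma avoiding_seq_lift (p : seq G) :
  x \notin p -> exists q : seq H, p = map del_val q.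
Proof.
elim: p => [_|y p IHp]; first by exists [::].
rewrite inE negb_or eq_sym => /andP[yx /IHp[q ->]].
by exists ((Sub y yx : {y : G | y != x}) :: q).
Qed.

Variable X : {set H}.
Hypothesis visX : mutual_visibility_set X.
Local Notation X' := (del_val @: X).

Lemma del_val_imset_neq (u : G) : u \in X' -> u != x.
Proof. by case/imsetP => u' _ ->; apply: del_val_neq. Qed.

Lemma mutual_visibility_through (Y : {set G}) :
  Y \subset X' -> (forall u, u \in Y -> visible Y u x) ->
  mutual_visibility_set Y.
Proof.
move=> /subsetP sYX visY u v uY vY.
have /imsetP[u' u'X def_u] := sYX u uY; have /imsetP[v' v'X def_v] := sYX v vY.
have [p sp Hp] := visX u'X v'X.
have [pmin|] := pselect (forall q, is_walk u v q -> size p <= size q).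
  exists (map del_val p).
    apply: shortest_walk_path; last by move=> q; rewrite size_map; apply: pmin.
    by rewrite def_u def_v; apply/is_walk_del_val/is_path_walk; case: sp.
  move=> w; rewrite def_u -map_cons => /mapP[w' w'p ->] /sYX.
  rewrite (mem_imset _ _ del_val_inj) => /(Hp _ w'p)[->|->]; first by left.
  by right.
move=> /existsNP[q /not_implyP[wq /negP]]; rewrite -ltnNge => qp.
have [pu spu Hpu] := visY u uY; have [pv spv Hpv] := visY v vY.
(* A walk avoiding [x] lifts to [H], where [p] is shortest. So a walk shorter than [p] splits at [x]
   into two parts, no shorter than [pu] and [pv] respectively. *)
have short r : is_walk u v r -> size r < size p -> size pu + size pv <= size r.
  move=> wr rp; have [xr|xr] := boolP (x \in u :: r); last first.
    have /avoiding_seq_lift[r' def_r] : x \notin r.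
      by apply: contra xr; rewrite inE => ->; rewrite orbT.
    move: wr rp; rewrite def_r def_u def_v size_map => /is_walk_del_val wr.
    by rewrite ltnNge (shortest_path_min sp wr).
  have [r1 [r2 [-> wr1 wr2]]] := is_walk_split wr xr.
  rewrite size_cat leq_add ?(shortest_path_min spu wr1) //.
  have := shortest_path_min spv (is_walk_rev wr2).
  by rewrite size_rev size_belast.
have size_glued : size (pu ++ rev (belast v pv)) = size pu + size pv.
  by rewrite size_cat size_rev size_belast.
exists (pu ++ rev (belast v pv)).
  apply: shortest_walk_path => [|r wr].
    apply: (is_walk_cat (w := x)); first by apply: is_path_walk; case: spu.
    by apply: is_walk_rev; apply: is_path_walk; case: spv.
  (* If [r] is at least as long as [p], it is compared through [q]: the glued walk is no longer than
     [q], which is shorter than [p]. *)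
  rewrite size_glued; case: (ltnP (size r) (size p)) => [|pr]; first exact: short.
  by apply: leq_trans (short q wq qp) _; apply: leq_trans (ltnW qp) pr.
(* Each half meets [Y] at most in its endpoints, and the common endpoint [x] is not in [Y]. *)
move=> w; rewrite -cat_cons mem_cat mem_rev => /orP[wpu|/mem_belast wpv] wY;
  have /eqP wx := del_val_imset_neq (sYX w wY).
- by have [->|] := Hpu w wpu wY; [left|].
- by have [->|] := Hpv w wpv wY; [right|].
Qed.

(** This is the set [A] of the opening comment, taken inside [G]. *)
Definition seeing_deleted : {set G} := [set u in X' | `[< visible X' u x >]].

Lemma visible_unseeing (u : G) :
  connected G -> u \in X' -> visible (X' :\: seeing_deleted) u x.
Proof.
move=> connG uX; have [p sp] := shortest_path_exists u x connG.
have [p1 [p2 [def_p wX p2X]]] := split_last_in p uX.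
have [[pp lp up] _] := sp; rewrite def_p in sp pp lp up.
set w := last u p1 in wX.
have [wp1 wp2] : is_walk u w p1 /\ is_walk w x p2.
  by move: pp lp; rewrite cat_path last_cat => /andP[].
have wA : w \in seeing_deleted.
  rewrite inE wX; apply/asboolP; exists p2.
    exact: shortest_path_suffix sp wp1 wp2.
  by move=> y; rewrite inE => /orP[/eqP ->|/p2X /negP //]; left.
(* Since [w] differs from [x], the end [x] of the path occurs in [p2], hence not in [p1]. So [p1]
   lifts to [H] and bounds the length of the geodesic [q] there. *)
have xp1 : x \notin p1.
  have xp2 : x \in p2.
    have := mem_last w p2; rewrite (proj2 wp2) inE eq_sym.
    by rewrite (negPf (del_val_imset_neq wX)).
  move: up; rewrite -cat_cons cat_uniq => /and3P[_ /hasPn/(_ x xp2) /= xup1 _].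
  by apply: contra xup1; rewrite inE => ->; rewrite orbT.
have [q1 def_p1] := avoiding_seq_lift xp1.
have /imsetP[u' u'X def_u] := uX; have /imsetP[w' w'X def_w] := wX.
have [q sq Hq] := visX u'X w'X.
have wq : is_walk u w (map del_val q).
  by rewrite def_u def_w; apply/is_walk_del_val/is_path_walk; case: sq.
have qp1 : size q <= size p1.
  rewrite def_p1 size_map; apply: shortest_path_min sq _.
  by apply/is_walk_del_val; rewrite -def_u -def_w -def_p1.
exists (map del_val q ++ p2).
  apply: shortest_walk_path => [|r wr]; first exact: is_walk_cat wq wp2.
  apply: leq_trans (shortest_path_min sp wr).
  by rewrite !size_cat size_map leq_add2r.
(* The part [p2] misses [X'], while [q] meets it only in [u] and [w]; as a member of
   [seeing_deleted], [w] is no obstacle. *)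
move=> y; rewrite -cat_cons mem_cat => /orP[yq|/p2X/negPf yX]; last first.
  by rewrite inE yX andbF.
rewrite inE => /andP[yA yX]; left; move: yq yA yX.
rewrite {1}def_u -map_cons => /mapP[y' y'q ->] yA.
rewrite (mem_imset _ _ del_val_inj) => /(Hq _ y'q)[->|def_y]; first by rewrite -def_u.
by rewrite def_y -def_w wA in yA.
Qed.

Lemma card_mutual_visibility_del : connected G -> #|X| <= 2 * mu G.
Proof.
move=> connG.
have le_mu (Y : {set G}) : mutual_visibility_set Y -> #|Y| <= mu G.
  by move=> visY; apply: leq_bigmax_cond; apply/asboolP.
have sAX : seeing_deleted \subset X' by apply/subsetP => u; rewrite inE => /andP[].
rewrite -(card_imset _ del_val_inj) -(cardsID seeing_deleted) mul2n -addnn.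
rewrite (setIidPr sAX) leq_add //; apply: le_mu;
  apply: mutual_visibility_through; rewrite ?subsetDl // => u.
- by rewrite inE => /andP[_ /asboolP]; apply: visible_sub.
- by rewrite inE => /andP[_ uX]; apply: visible_unseeing.
Qed.

End DeletedVertex.

Theorem theorem5p5 (G : sgraph) (x : G) (connG : connected G)
    (connGx : connected (del_vertex x)) :
  mu (del_vertex x) <= 2 * mu G.
Proof.
apply/bigmax_leqP => X /asboolP visX.
exact: card_mutual_visibility_del visX connG.
Qed.
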